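(* Let $R$ be a commutative artinian ring, and let $\Phi=\{\Phi_i\}_{i=1}^n$ be an $\mathbb{E}$-stratifying system in an artin $R$-linear extriangulated category $(\mathcal{A},\mathbb{E},\mathfrak{s})$. Then there is a set $Q=\{Q_i\}_{i=1}^n$ of objects in $\mathcal{F}(\Phi)$ such that $(\Phi,Q)$ is a minimal projective $\mathbb{E}$-stratifying system.
   Context: **Extriangulated category** (Nakaoka--Palu): a triple $(\mathcal{A},\mathbb{E},\mathfrak{s})$ with $\mathcal{A}$ an additive category, $\mathbb{E}\colon\mathcal{A}^{\mathrm{op}}\times\mathcal{A}\to\mathsf{Ab}$ a biadditive functor, and $\mathfrak{s}$ as follows. Elements $\delta\in\mathbb{E}(C,A)$ are extensions; for $x\colon A\to A'$, $z\colon C'\to C$ put $x_*\delta=\mathbb{E}(C,x)(\delta)$, $z^*\delta=\mathbb{E}(z,A)(\delta)$. A morphism of extensions from $\delta\in\mathbb{E}(C,A)$ to $\delta'\in\mathbb{E}(C',A')$ is a pair $(f\colon A\to A',h\colon C\to C')$ with $f_*\delta=h^*\delta'$. The sum $\delta\oplus\delta'\in\mathbb{E}(C\oplus C',A\oplus A')$ corresponds to $(\delta,0,0,\delta')$. Sequences $A\to B\to C$ and $A\to B'\to C$ are equivalent if there is an isomorphism $B\to B'$ commuting with identities on $A$ and $C$. To each $\delta\in\mathbb{E}(C,A)$, $\mathfrak{s}$ assigns an equivalence class $\mathfrak{s}(\delta)=[A\xrightarrow{a}B\xrightarrow{b}C]$ such that: every morphism of extensions $(f,h)\colon\delta\to\delta'$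 is completed by some $g$ with $ga=a'f$, $hb=b'g$; $\mathfrak{s}(0)$ is the class of the split sequence $A\to A\oplus C\to C$; $\mathfrak{s}(\delta\oplus\delta')=\mathfrak{s}(\delta)\oplus\mathfrak{s}(\delta')$. If $\mathfrak{s}(\delta)=[A\xrightarrow{a}B\xrightarrow{b}C]$, then $A\xrightarrow{a}B\xrightarrow{b}C\overset{\delta}{\dashrightarrow}$ is called an extriangle, $a$ an inflation and $b$ a deflation. Axioms: (ET3) for two extriangles and $f,g$ with $ga=a'f$ there is $h$ with $hb=b'g$ and $(f,h)$ a morphism of extensions; (ET4) for extriangles $A\xrightarrow{f}B\xrightarrow{f'}D\overset{\delta}{\dashrightarrow}$ and $B\xrightarrow{g}C\xrightarrow{g'}F\overset{\delta'}{\dashrightarrow}$ there are an extriangle $A\xrightarrow{gf}C\xrightarrow{h'}E\overset{\delta''}{\dashrightarrow}$ and morphisms $d\colon D\to E$, $e\colon E\to F$ with $df'=h'g$, $eh'=g'$, $D\xrightarrow{d}E\xrightarrow{e}F\overset{f'_*\delta'}{\dashrightarrow}$ an extriangle, $d^*\delta''=\delta$, $f_*\delta''=e^*\delta'$; and the duals (ET3)$^{\mathrm{op}}$, (ET4)$^{\mathrm{op}}$. **Artin $R$-linear extriangulated category** ($R$ commutative artinian): $\mathcal{A}$ is $R$-linear, $\mathbb{E}$ takes values in $R$-modules and is $R$-bilinear, $\mathcal{A}$ is idempotent complete, and all $\mathcal{A}(X,Y)$ and $\mathbb{E}(X,Y)$ are finite length $R$-modules. **Filtrations.** For a class $\mathcal{X}$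 of objects, an $\mathcal{X}$-filtration of $M$ of length $t\ge 0$ is a sequence $(\xi_0,\dots,\xi_t)$ of extriangles $M_{i-1}\to M_i\to X_i\overset{\xi_i}{\dashrightarrow}$ with $M_{-1}=M_0=X_0=0$, $M_t=M$, and $X_i\in\mathcal{X}$ for $1\le i\le t$. $\mathcal{F}(\mathcal{X})$ is the full subcategory of objects admitting an $\mathcal{X}$-filtration ($\mathcal{F}(\emptyset)=\{0\}$). **$\mathbb{E}$-stratifying system**: a finite collection $\Phi=\{\Phi_1,\dots,\Phi_n\}$ of indecomposable objects of $\mathcal{A}$ with (S1) $\mathcal{A}(\Phi_j,\Phi_i)=0$ whenever $j>i$, and (S2) $\mathbb{E}(\Phi_j,\Phi_i)=0$ whenever $j\ge i$. **Projective $\mathbb{E}$-stratifying system**: a pair $(\Phi,Q)$ with $\Phi=\{\Phi_i\}_{i=1}^n$ an $\mathbb{E}$-stratifying system and $Q=\{Q_i\}_{i=1}^n$ a set of objects of $\mathcal{A}$ (some $Q_i$ may be zero) such that (PS1) $\mathbb{E}(Q_i,\Phi_j)=0$ for all $1\le i,j\le n$; (PS2) for each $i$ there is an extriangle $K_i\xrightarrow{k_i}Q_i\xrightarrow{q_i}\Phi_i\overset{\eta_i}{\dashrightarrow}$ with $K_i\in\mathcal{F}(\{\Phi_j\mid j>i\})$. It is **minimal** if each $q_i$ is right minimal, i.e. every endomorphism $g$ of $Q_i$ with $q_ig=q_i$ is an automorphism. *)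

(* Defs.v *)
From HB Require Import structures.
From mathcomp Require Import all_boot all_algebra.
From mathcomp Require Import boolp classical_sets.

Set Implicit Arguments.
Unset Strict Implicit.
Unset Printing Implicit Defensive.

Import GRing.Theory.
Local Open Scope ring_scope.
Local Open Scope classical_set_scope.

Definition submodule (R : comPzRingType) (M : lmodType R) (N : set M) : Prop :=
  submod_closed (mem N : {pred M}).

Definition artinian (R : comPzRingType) : Prop :=
  forall I : nat -> set R^o,
    (forall i, submodule (I i)) -> (forall i, I i.+1 `<=` I i) ->
    exists m, forall i, (m <= i)%N -> I i = I m.

(* The witness is a composition series: consecutive terms are distinct and
   have no submodule strictly between them. *)
Definition finite_length (R : comPzRingType) (M : lmodType R) : Prop :=
  exists (l : nat) (N : nat -> set M),
    [/\ N 0%N = [set 0], N l = setT,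
        (forall i, (i <= l)%N -> submodule (N i)) &
        forall i, (i < l)%N ->
          [/\ N i `<=` N i.+1, N i <> N i.+1 &
              forall K : set M, submodule K ->
                N i `<=` K -> K `<=` N i.+1 -> K = N i \/ K = N i.+1]].

Reserved Notation "g ∘ f" (at level 40, left associativity).

Record linCat (R : comPzRingType) := LinCat {
  ob :> Type;
  hom : ob -> ob -> lmodType R;
  idm : forall X, hom X X;
  compm : forall X Y Z, hom Y Z -> hom X Y -> hom X Z
    where "g ∘ f" := (compm g f);
  compmA : forall X Y Z W (h : hom Z W) (g : hom Y Z) (f : hom X Y),
    h ∘ (g ∘ f) = (h ∘ g) ∘ f;
  comp1m : forall X Y (f : hom X Y), idm Y ∘ f = f;
  compm1 : forall X Y (f : hom X Y), f ∘ idm X = f;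
  compm_linearl : forall X Y Z (f : hom X Y),
    linear (fun g : hom Y Z => g ∘ f);
  compm_linearr : forall X Y Z (g : hom Y Z),
    linear (fun f : hom X Y => g ∘ f)
}.
Arguments idm {R l} X.
Notation "g ∘ f" := (compm g f).

Record addCat (R : comPzRingType) := AddCat {
  lincat :> linCat R;
  zeroob : lincat;
  zeroobP : idm zeroob = 0;
  dsum : lincat -> lincat -> lincat;
  in1 : forall X Y, hom X (dsum X Y);
  in2 : forall X Y, hom Y (dsum X Y);
  pr1 : forall X Y, hom (dsum X Y) X;
  pr2 : forall X Y, hom (dsum X Y) Y;
  pr1_in1 : forall X Y, pr1 X Y ∘ in1 X Y = idm X;
  pr2_in2 : forall X Y, pr2 X Y ∘ in2 X Y = idm Y;
  pr1_in2 : forall X Y, pr1 X Y ∘ in2 X Y = 0;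
  pr2_in1 : forall X Y, pr2 X Y ∘ in1 X Y = 0;
  dsum_id : forall X Y, in1 X Y ∘ pr1 X Y + in2 X Y ∘ pr2 X Y = idm (dsum X Y)
}.
Arguments in1 {R a} X Y.
Arguments in2 {R a} X Y.
Arguments pr1 {R a} X Y.
Arguments pr2 {R a} X Y.

Definition is_zero (R : comPzRingType) (A : addCat R) (X : A) : Prop :=
  idm X = 0.

Definition is_iso (R : comPzRingType) (A : addCat R) (X Y : A) (f : hom X Y)
  : Prop :=
  exists g : hom Y X, g ∘ f = idm X /\ f ∘ g = idm Y.

Definition isomorphic (R : comPzRingType) (A : addCat R) (X Y : A) : Prop :=
  exists f : hom X Y, is_iso f.

Definition indecomposable (R : comPzRingType) (A : addCat R) (X : A) : Prop :=
  ~ is_zero X /\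
  forall Y Z : A, isomorphic X (dsum Y Z) -> is_zero Y \/ is_zero Z.

Definition idempotent_complete (R : comPzRingType) (A : addCat R) : Prop :=
  forall (X : A) (e : hom X X), e ∘ e = e ->
  exists (Y : A) (r : hom X Y) (s : hom Y X), s ∘ r = e /\ r ∘ s = idm Y.

Definition dsum_map (R : comPzRingType) (A : addCat R) (X X' Y Y' : A)
    (f : hom X Y) (f' : hom X' Y') : hom (dsum X X') (dsum Y Y') :=
  in1 Y Y' ∘ f ∘ pr1 X X' + in2 Y Y' ∘ f' ∘ pr2 X X'.

Definition seq_equiv (R : comPzRingType) (A : addCat R) (X Z Y Y' : A)
    (a : hom X Y) (b : hom Y Z) (a' : hom X Y') (b' : hom Y' Z) : Prop :=
  exists g : hom Y Y', [/\ is_iso g, g ∘ a = a' & b' ∘ g = b].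

(* [ext C A] is E(C, A); [push x d] is x_* d and [pull z d] is z^* d. *)
Record extFun (R : comPzRingType) (A : addCat R) := ExtFun {
  ext : A -> A -> lmodType R;
  push : forall Z X X' : A, hom X X' -> ext Z X -> ext Z X';
  pull : forall Z Z' X : A, hom Z' Z -> ext Z X -> ext Z' X;
  push_id : forall Z X (d : ext Z X), push (idm X) d = d;
  pull_id : forall Z X (d : ext Z X), pull (idm Z) d = d;
  push_comp : forall Z X X' X'' (x' : hom X' X'') (x : hom X X') (d : ext Z X),
    push (x' ∘ x) d = push x' (push x d);
  pull_comp : forall Z Z' Z'' X (z : hom Z' Z) (z' : hom Z'' Z') (d : ext Z X),
    pull (z ∘ z') d = pull z' (pull z d);
  push_pull : forall Z Z' X X' (x : hom X X') (z : hom Z' Z) (d : ext Z X),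
    push x (pull z d) = pull z (push x d);
  push_linear : forall Z X X' (x : hom X X'),
    linear (fun d : ext Z X => push x d);
  pull_linear : forall Z Z' X (z : hom Z' Z),
    linear (fun d : ext Z X => pull z d);
  push_linear_hom : forall Z X X' (d : ext Z X),
    linear (fun x : hom X X' => push x d);
  pull_linear_hom : forall Z Z' X (d : ext Z X),
    linear (fun z : hom Z' Z => pull z d)
}.

(* The extension with components (d, 0, 0, d'); see [ext_sumP]. *)
Definition ext_sum (R : comPzRingType) (A : addCat R) (E : extFun A)
    (Z Z' X X' : A) (d : ext E Z X) (d' : ext E Z' X')
    : ext E (dsum Z Z') (dsum X X') :=
  push (in1 X X') (pull (pr1 Z Z') d) + push (in2 X X') (pull (pr2 Z Z') d').

Definition ext_morph (R : comPzRingType) (A : addCat R) (E : extFun A)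
    (Z Z' X X' : A) (d : ext E Z X) (d' : ext E Z' X')
    (f : hom X X') (h : hom Z Z') : Prop :=
  push f d = pull h d'.

(* [realizes d a b] says that the equivalence class s(d) contains the sequence
   X -a-> Y -b-> Z; [realizes_ex] and [realizes_class] say that the sequences
   with this property form exactly one equivalence class. *)
Record extriCat (R : comPzRingType) := ExtriCat {
  addcat :> addCat R;
  extfun : extFun addcat;
  realizes : forall Z X : addcat, ext extfun Z X ->
    forall Y : addcat, hom X Y -> hom Y Z -> Prop;

  realizes_ex : forall Z X (d : ext extfun Z X),
    exists (Y : addcat) (a : hom X Y) (b : hom Y Z), realizes d a b;
  realizes_class : forall Z X (d : ext extfun Z X)
      Y (a : hom X Y) (b : hom Y Z) Y' (a' : hom X Y') (b' : hom Y' Z),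
    realizes d a b -> (realizes d a' b' <-> seq_equiv a b a' b');

  realizes_morph : forall Z X (d : ext extfun Z X) Z' X' (d' : ext extfun Z' X')
      Y (a : hom X Y) (b : hom Y Z) Y' (a' : hom X' Y') (b' : hom Y' Z')
      (f : hom X X') (h : hom Z Z'),
    realizes d a b -> realizes d' a' b' -> ext_morph d d' f h ->
    exists g : hom Y Y', g ∘ a = a' ∘ f /\ h ∘ b = b' ∘ g;
  realizes_0 : forall Z X,
    realizes (0 : ext extfun Z X) (in1 X Z) (pr2 X Z);
  realizes_sum : forall Z X (d : ext extfun Z X) Z' X' (d' : ext extfun Z' X')
      Y (a : hom X Y) (b : hom Y Z) Y' (a' : hom X' Y') (b' : hom Y' Z'),
    realizes d a b -> realizes d' a' b' ->
    realizes (ext_sum d d') (dsum_map a a') (dsum_map b b');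

  ET3 : forall Z X (d : ext extfun Z X) Z' X' (d' : ext extfun Z' X')
      Y (a : hom X Y) (b : hom Y Z) Y' (a' : hom X' Y') (b' : hom Y' Z')
      (f : hom X X') (g : hom Y Y'),
    realizes d a b -> realizes d' a' b' -> g ∘ a = a' ∘ f ->
    exists h : hom Z Z', h ∘ b = b' ∘ g /\ ext_morph d d' f h;
  ET3op : forall Z X (d : ext extfun Z X) Z' X' (d' : ext extfun Z' X')
      Y (a : hom X Y) (b : hom Y Z) Y' (a' : hom X' Y') (b' : hom Y' Z')
      (g : hom Y Y') (h : hom Z Z'),
    realizes d a b -> realizes d' a' b' -> h ∘ b = b' ∘ g ->
    exists f : hom X X', g ∘ a = a' ∘ f /\ ext_morph d d' f h;

  ET4 : forall (A B C D F : addcat)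
      (f : hom A B) (f' : hom B D) (d1 : ext extfun D A)
      (g : hom B C) (g' : hom C F) (d2 : ext extfun F B),
    realizes d1 f f' -> realizes d2 g g' ->
    exists (E : addcat) (h' : hom C E) (d3 : ext extfun E A)
           (d : hom D E) (e : hom E F),
      [/\ realizes d3 (g ∘ f) h', realizes (push f' d2) d e,
          d ∘ f' = h' ∘ g, e ∘ h' = g' &
          pull d d3 = d1 /\ push f d3 = pull e d2];
  ET4op : forall (A B C D F : addcat)
      (f' : hom D A) (f : hom A B) (d1 : ext extfun B D)
      (g' : hom F B) (g : hom B C) (d2 : ext extfun C F),
    realizes d1 f' f -> realizes d2 g' g ->
    exists (E : addcat) (h' : hom E A) (d3 : ext extfun C E)
           (d : hom D E) (e : hom E F),
      [/\ realizes d3 h' (g ∘ f), realizes (pull g' d1) d e,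
          f ∘ h' = g' ∘ e, h' ∘ d = f' &
          push e d3 = d2 /\ pull g d3 = push d d1]
}.

Definition EE (R : comPzRingType) (A : extriCat R) (Z X : A) : lmodType R :=
  ext (extfun A) Z X.

Definition extriangle (R : comPzRingType) (A : extriCat R) (X Y Z : A)
    (a : hom X Y) (b : hom Y Z) (d : EE Z X) : Prop :=
  realizes d a b.

Definition artin (R : comPzRingType) (A : extriCat R) : Prop :=
  [/\ idempotent_complete A,
      (forall X Y : A, finite_length (hom X Y)) &
      (forall X Y : A, finite_length (EE X Y))].

(* [stage i] is M_(i-1), so the i-th extriangle is
   stage i -> stage i.+1 -> factor i.  The data beyond index t is unused. *)
Record filtration (R : comPzRingType) (A : extriCat R) (P : A -> Prop)
    (M : A) (t : nat) := Filtration {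
  stage : nat -> A;
  factor : nat -> A;
  stage_inf : forall i, hom (stage i) (stage i.+1);
  stage_def : forall i, hom (stage i.+1) (factor i);
  stage_ext : forall i, EE (factor i) (stage i);
  stage_tri : forall i, (i <= t)%N ->
    extriangle (stage_inf i) (stage_def i) (stage_ext i);
  stage0 : is_zero (stage 0);
  stage1 : is_zero (stage 1);
  factor0 : is_zero (factor 0);
  stage_top : stage t.+1 = M;
  factorP : forall i, (1 <= i <= t)%N -> P (factor i)
}.

Definition filtered (R : comPzRingType) (A : extriCat R) (P : A -> Prop)
    (M : A) : Prop :=
  exists t, inhabited (filtration P M t).

Definition stratifying_system (R : comPzRingType) (A : extriCat R) (n : nat)
    (Phi : 'I_n -> A) : Prop :=
  [/\ forall i, indecomposable (Phi i),
      forall i j : 'I_n, (i < j)%N -> forall f : hom (Phi j) (Phi i), f = 0 &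
      forall i j : 'I_n, (i <= j)%N -> forall d : EE (Phi j) (Phi i), d = 0].

Record proj_stratifying_system (R : comPzRingType) (A : extriCat R) (n : nat)
    (Phi Q : 'I_n -> A) := ProjStratifyingSystem {
  ps_strat : stratifying_system Phi;
  ps_proj : forall (i j : 'I_n) (d : EE (Q i) (Phi j)), d = 0;
  ps_K : 'I_n -> A;
  ps_k : forall i, hom (ps_K i) (Q i);
  ps_q : forall i, hom (Q i) (Phi i);
  ps_eta : forall i, EE (Phi i) (ps_K i);
  ps_tri : forall i, extriangle (ps_k i) (ps_q i) (ps_eta i);
  ps_filt : forall i : 'I_n,
    filtered (fun X => exists j : 'I_n, (i < j)%N /\ X = Phi j) (ps_K i)
}.

Definition right_minimal (R : comPzRingType) (A : extriCat R) (X Y : A)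
    (q : hom X Y) : Prop :=
  forall g : hom X X, q ∘ g = q -> is_iso g.

Definition minimal (R : comPzRingType) (A : extriCat R) (n : nat)
    (Phi Q : 'I_n -> A) (S : proj_stratifying_system Phi Q) : Prop :=
  forall i, right_minimal (ps_q S i).

Lemma push0 (R : comPzRingType) (A : addCat R) (E : extFun A) (Z X X' : A)
  (d : ext E Z X) : push (0 : hom X X') d = 0.
Proof.
have h := push_linear_hom (X' := X') d.
by have := h (-1) 0 0; rewrite scaler0 addr0 scaleN1r addNr.
Qed.

Lemma pull0 (R : comPzRingType) (A : addCat R) (E : extFun A) (Z Z' X : A)
  (d : ext E Z X) : pull (0 : hom Z' Z) d = 0.
Proof.
have h := pull_linear_hom (Z' := Z') d.
by have := h (-1) 0 0; rewrite scaler0 addr0 scaleN1r addNr.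
Qed.

Lemma pushD (R : comPzRingType) (A : addCat R) (E : extFun A) (Z X X' : A)
  (x : hom X X') (d d' : ext E Z X) : push x (d + d') = push x d + push x d'.
Proof. by have := push_linear x 1 d d'; rewrite !scale1r. Qed.

Lemma pullD (R : comPzRingType) (A : addCat R) (E : extFun A) (Z Z' X : A)
  (z : hom Z' Z) (d d' : ext E Z X) : pull z (d + d') = pull z d + pull z d'.
Proof. by have := pull_linear z 1 d d'; rewrite !scale1r. Qed.

Lemma ext_component (R : comPzRingType) (A : addCat R) (E : extFun A)
  (Z0 Z Z1 X0 X X1 : A) (p : hom X X1) (i : hom X0 X) (j : hom Z1 Z)
  (q : hom Z Z0) (d : ext E Z0 X0) :
  push p (pull j (push i (pull q d))) = push (p ∘ i) (pull (q ∘ j) d).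
Proof. by rewrite -push_pull -push_comp pull_comp. Qed.

Lemma ext_sumP (R : comPzRingType) (A : addCat R) (E : extFun A)
  (Z Z' X X' : A) (d : ext E Z X) (d' : ext E Z' X') (u : ext E _ _) :
  u = ext_sum d d' <->
  [/\ push (pr1 X X') (pull (in1 Z Z') u) = d,
      push (pr1 X X') (pull (in2 Z Z') u) = 0,
      push (pr2 X X') (pull (in1 Z Z') u) = 0 &
      push (pr2 X X') (pull (in2 Z Z') u) = d'].
Proof.
split=> [->|[u11 u12 u21 u22]].
  rewrite /ext_sum !pullD !pushD !ext_component.
  rewrite !pr1_in1 !pr1_in2 !pr2_in1 !pr2_in2 !push_id !pull_id !push0 !pull0.
  by split; rewrite ?push_id ?addr0 ?add0r.
have pushE (W : A) (v : ext E W (dsum X X')) :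
    v = push (in1 X X') (push (pr1 X X') v)
        + push (in2 X X') (push (pr2 X X') v).
  rewrite -{1}[v]push_id -dsum_id -!push_comp.
  by have := push_linear_hom v 1 (in1 X X' ∘ pr1 X X') (in2 X X' ∘ pr2 X X');
     rewrite !scale1r.
have pullE (W : A) (v : ext E (dsum Z Z') W) :
    v = pull (pr1 Z Z') (pull (in1 Z Z') v)
        + pull (pr2 Z Z') (pull (in2 Z Z') v).
  rewrite -{1}[v]pull_id -dsum_id -!pull_comp.
  by have := pull_linear_hom v 1 (in1 Z Z' ∘ pr1 Z Z') (in2 Z Z' ∘ pr2 Z Z');
     rewrite !scale1r.
have pz (V V' W : A) (z : hom V' V) : pull z (0 : ext E V W) = 0.
  by have := pull_linear z (-1) 0 (0 : ext E V W);
     rewrite scaler0 addr0 scaleN1r addNr.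
rewrite {1}[u]pushE {1}[push (pr1 X X') u]pullE {1}[push (pr2 X X') u]pullE.
rewrite !push_pull in u11 u12 u21 u22.
by rewrite u11 u12 u21 u22 !pz addr0 add0r.
Qed.

(* Main.v *)
(* Start from [Phi i] and, for j = i+1, ..., n in turn, kill the extensions by
   [Phi j]: take the universal extension P -> Q' -> Q, where P is a power of
   [Phi j], built on a minimal generating family of E(Q, Phi j) over
   End(Phi j).  As Hom(P, Q) = 0, an endomorphism of Q' induces
   endomorphisms of P and Q; by minimality, the one of P is nilpotent, or an
   isomorphism, as soon as the one of Q is.  So every endomorphism of Q' is
   nilpotent or an isomorphism whenever this holds for Q, and for such a Q'
   a morphism to [Phi i] is right minimal as soon as it is nonzero or Q' = 0.
   No summand of a filtered object ever has to be split off. *)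

From HB Require Import structures.
From mathcomp Require Import all_boot all_algebra.
From mathcomp Require Import boolp classical_sets.
Require Import Defs.

Set Implicit Arguments.
Unset Strict Implicit.
Unset Printing Implicit Defensive.

Import GRing.Theory.
Local Open Scope ring_scope.
Local Open Scope classical_set_scope.

(** * Submodules and composition length *)

Lemma submoduleP (R : comPzRingType) (M : lmodType R) (N : set M) :
  submodule N <-> N 0 /\ forall a u v, N u -> N v -> N (a *: u + v).
Proof.
rewrite /submodule /GRing.submod_closed; split=> [[N0 NL]|[N0 NL]]; split.
- exact: set_mem N0.
- by move=> a u v Nu Nv; apply: set_mem; apply: NL; apply: mem_set.
- exact: mem_set.
- move=> a u v /set_mem Nu /set_mem Nv; apply: mem_set; exact: NL.
Qed.

(* A submodule [K] is determined, among the submodules of a larger one, by the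
   set of factors of a composition series that it meets; [len K] counts them. *)
Lemma finite_length_measure (R : comPzRingType) (M : lmodType R) :
  finite_length M -> exists len : set M -> nat,
    (forall K K' : set M, K `<=` K' -> (len K <= len K')%N) /\
    (forall K K' : set M, submodule K -> submodule K' ->
       K `<=` K' -> K <> K' -> (len K < len K')%N).
Proof.
move=> [l [N [N0 Nl Nsub Nsimple]]].
pose meets (K : set M) (i : 'I_l) := `[< exists x, [/\ K x, N i.+1 x & ~ N i x] >].
have meetsS K K' : K `<=` K' -> {subset meets K <= meets K'}.
  move=> KK' i /asboolP[x [Kx Nx nNx]]; apply/asboolP.
  by exists x; split=> //; apply: KK'.
exists (fun K => #|meets K|); split=> [K K' KK'|K K' Ksub K'sub KK' neqKK'].
  by apply: subset_leq_card; apply/fintype.subsetP => i; apply: meetsS.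
apply: proper_card; apply/properP; split.
  by apply/fintype.subsetP => i; apply: meetsS.
apply: contra_notP neqKK' => noi.
have same i : meets K' i -> meets K i.
  by move=> K'i; apply: contrapT => nKi; apply: noi; exists i => //; apply/negP.
have [K0 KL] := (submoduleP _).1 Ksub; have [K'0 K'L] := (submoduleP _).1 K'sub.
apply/seteqP; split=> // x K'x.
suff: forall i, (i <= l)%N -> forall y, N i y -> K' y -> K y.
  by move=> /(_ l (leqnn l) x); rewrite Nl; apply.
elim=> [_ y|i IH lt_il y Ny K'y]; first by rewrite N0 => ->.
have [Niy|nNiy] := pselect (N i y); first exact: IH (ltnW lt_il) _ Niy K'y.
have /asboolP/=[z [Kz Nz nNz]] : meets K (Ordinal lt_il).
  by apply: same; apply/asboolP; exists y.
have [NiS _ simple] := Nsimple i lt_il.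
have [Ni0 NiL] := (submoduleP _).1 (Nsub i (ltnW lt_il)).
have [NSi0 NSiL] := (submoduleP _).1 (Nsub i.+1 lt_il).
(* By simplicity [L], which contains [z], is all of [N i.+1], so [y] is an element of [K] up to one
   of [N i]. *)
pose L := [set w | exists k n, [/\ K k, N i.+1 k, N i n & w = k + n]].
have Lsub : submodule L.
  apply/submoduleP; split; first by exists 0, 0; rewrite addr0.
  move=> a _ _ [k [n [Kk Nk Nn ->]]] [k' [n' [Kk' Nk' Nn' ->]]].
  exists (a *: k + k'), (a *: n + n'); split.
  - exact: KL.
  - exact: NSiL.
  - exact: NiL.
  - by rewrite scalerDr addrACA.
have [||LE|LE] := simple L Lsub.
- by move=> w Nw; exists 0, w; rewrite add0r; split.
- move=> _ [k [n [Kk Nk Nn ->]]]; rewrite -[k]scale1r; apply: NSiL => //.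
  exact: NiS.
- by case: nNz; rewrite -LE; exists z, 0; rewrite addr0; split.
have [k [n [Kk Nk Nn yE]]] : L y by rewrite LE.
have K'n : K' n.
  have -> : n = (-1) *: k + y by rewrite yE scaleN1r addKr.
  by apply: K'L => //; apply: KK'.
have Kn := IH (ltnW lt_il) n Nn K'n.
by rewrite yE -[k]scale1r; apply: KL.
Qed.

(** * Linearity of composition and of the action on extensions *)

Lemma compDl (R : comPzRingType) (A : linCat R) (X Y Z : A) (f f' : hom Y Z)
  (g : hom X Y) : (f + f') ∘ g = f ∘ g + f' ∘ g.
Proof. by have := compm_linearl g 1 f f'; rewrite !scale1r. Qed.

Lemma compDr (R : comPzRingType) (A : linCat R) (X Y Z : A) (f : hom Y Z)
  (g g' : hom X Y) : f ∘ (g + g') = f ∘ g + f ∘ g'.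
Proof. by have := compm_linearr f 1 g g'; rewrite !scale1r. Qed.

Lemma comp0l (R : comPzRingType) (A : linCat R) (X Y Z : A) (g : hom X Y) :
  (0 : hom Y Z) ∘ g = 0.
Proof. by apply: (addIr (0 ∘ g)); rewrite -compDl !add0r. Qed.

Lemma comp0r (R : comPzRingType) (A : linCat R) (X Y Z : A) (f : hom Y Z) :
  f ∘ (0 : hom X Y) = 0.
Proof. by apply: (addIr (f ∘ 0)); rewrite -compDr !add0r. Qed.

Lemma compNl (R : comPzRingType) (A : linCat R) (X Y Z : A) (f : hom Y Z)
  (g : hom X Y) : (- f) ∘ g = - (f ∘ g).
Proof. by apply: (addIr (f ∘ g)); rewrite -compDl !addNr comp0l. Qed.

Lemma compNr (R : comPzRingType) (A : linCat R) (X Y Z : A) (f : hom Y Z)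
  (g : hom X Y) : f ∘ (- g) = - (f ∘ g).
Proof. by apply: (addIr (f ∘ g)); rewrite -compDr !addNr comp0r. Qed.

Lemma compZl (R : comPzRingType) (A : linCat R) (X Y Z : A) a (f : hom Y Z)
  (g : hom X Y) : (a *: f) ∘ g = a *: (f ∘ g).
Proof. by have := compm_linearl g a f 0; rewrite !addr0 comp0l addr0. Qed.

Lemma compZr (R : comPzRingType) (A : linCat R) (X Y Z : A) a (f : hom Y Z)
  (g : hom X Y) : f ∘ (a *: g) = a *: (f ∘ g).
Proof. by have := compm_linearr f a g 0; rewrite !addr0 comp0r addr0. Qed.

Lemma comp_suml (R : comPzRingType) (A : linCat R) (X Y Z : A) m
  (f : 'I_m -> hom Y Z) (g : hom X Y) :
  (\sum_(i < m) f i) ∘ g = \sum_(i < m) f i ∘ g.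
Proof.
by apply: (big_morph (fun f => f ∘ g)) => [u v|]; rewrite ?compDl ?comp0l.
Qed.

Lemma comp_sumr (R : comPzRingType) (A : linCat R) (X Y Z : A) m
  (f : hom Y Z) (g : 'I_m -> hom X Y) :
  f ∘ (\sum_(i < m) g i) = \sum_(i < m) f ∘ g i.
Proof.
by apply: (big_morph (fun g => f ∘ g)) => [u v|]; rewrite ?compDr ?comp0r.
Qed.

Lemma zero_dom (R : comPzRingType) (A : addCat R) (X Y : A) (f : hom X Y) :
  is_zero X -> f = 0.
Proof. by move=> X0; rewrite -[f]compm1 X0 comp0r. Qed.

Lemma zero_cod (R : comPzRingType) (A : addCat R) (X Y : A) (f : hom X Y) :
  is_zero Y -> f = 0.
Proof. by move=> Y0; rewrite -[f]comp1m Y0 comp0l. Qed.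

Lemma pushDh (R : comPzRingType) (A : addCat R) (E : extFun A) (Z X X' : A)
  (x x' : hom X X') (d : ext E Z X) : push (x + x') d = push x d + push x' d.
Proof. by have := push_linear_hom d 1 x x'; rewrite !scale1r. Qed.

Lemma pushNh (R : comPzRingType) (A : addCat R) (E : extFun A) (Z X X' : A)
  (x : hom X X') (d : ext E Z X) : push (- x) d = - push x d.
Proof. by apply: (addIr (push x d)); rewrite -pushDh !addNr push0. Qed.

Lemma pushZh (R : comPzRingType) (A : addCat R) (E : extFun A) (Z X X' : A)
  a (x : hom X X') (d : ext E Z X) : push (a *: x) d = a *: push x d.
Proof. by have := push_linear_hom d a x 0; rewrite !addr0 push0 addr0. Qed.

Lemma pushr0 (R : comPzRingType) (A : addCat R) (E : extFun A) (Z X X' : A)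
  (x : hom X X') : push x (0 : ext E Z X) = 0.
Proof. by apply: (addIr (push x 0)); rewrite -pushD !add0r. Qed.

Lemma pullr0 (R : comPzRingType) (A : addCat R) (E : extFun A) (Z Z' X : A)
  (z : hom Z' Z) : pull z (0 : ext E Z X) = 0.
Proof. by apply: (addIr (pull z 0)); rewrite -pullD !add0r. Qed.

Lemma push_sumh (R : comPzRingType) (A : addCat R) (E : extFun A) (Z X X' : A) m
  (x : 'I_m -> hom X X') (d : ext E Z X) :
  push (\sum_(i < m) x i) d = \sum_(i < m) push (x i) d.
Proof.
by apply: (big_morph (fun x => push x d)) => [u v|]; rewrite ?pushDh ?push0.
Qed.

Lemma push_sum (R : comPzRingType) (A : addCat R) (E : extFun A) (Z X X' : A) m
  (x : hom X X') (d : 'I_m -> ext E Z X) :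
  push x (\sum_(i < m) d i) = \sum_(i < m) push x (d i).
Proof.
by apply: (big_morph (push x)) => [u v|]; rewrite ?pushD ?pushr0.
Qed.

Lemma ext_zero_dom (R : comPzRingType) (A : addCat R) (E : extFun A) (Z X : A)
  (d : ext E Z X) : is_zero Z -> d = 0.
Proof. by move=> Z0; rewrite -[d]pull_id Z0 pull0. Qed.

(** * Endomorphism rings and Fitting's lemma *)

(* An alias carrying the ring structure, so that powers are available. *)
Definition endo (R : comPzRingType) (A : linCat R) (X : A) : Type := hom X X.

HB.instance Definition _ (R : comPzRingType) (A : linCat R) (X : A) :=
  GRing.Zmodule.on (endo X).
HB.instance Definition _ (R : comPzRingType) (A : linCat R) (X : A) :=
  GRing.Zmodule_isPzRing.Build (endo X)
    (fun h g f : endo X => compmA h g f) (@comp1m _ _ X X) (@compm1 _ _ X X)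
    (fun f g h : endo X => compDl f g h) (fun f g h : endo X => compDr f g h).

Lemma endoM (R : comPzRingType) (A : linCat R) (X : A) (f g : endo X) :
  f * g = (f : hom X X) ∘ (g : hom X X).
Proof. by []. Qed.

Lemma endo1 (R : comPzRingType) (A : linCat R) (X : A) :
  (1 : endo X) = idm X.
Proof. by []. Qed.

(* Fitting's lemma: [a] lies in the corner ring of the idempotent [e] and is
   invertible there. *)
Lemma fitting (R : comPzRingType) (A : linCat R) (X : A) (g : endo X) :
  finite_length (hom X X) -> exists (N : nat) (e x y : endo X),
    let a := g ^+ N.+1 in [/\ e = a * x, e = y * a, e * a = a & a * e = a].
Proof.
move=> /finite_length_measure[len [lenS ltlen]].
pose I n : set (hom X X) := [set g ^+ n.+1 * z | z in [set: endo X]].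
pose J n : set (hom X X) := [set z * g ^+ n.+1 | z in [set: endo X]].
have Isub n : submodule (I n).
  apply/submoduleP; split; first by exists 0; rewrite ?mulr0.
  move=> a _ _ [z _ <-] [z' _ <-]; exists (a *: (z : hom X X) + z' : hom X X) => //.
  by rewrite !endoM compDr compZr.
have Jsub n : submodule (J n).
  apply/submoduleP; split; first by exists 0; rewrite ?mul0r.
  move=> a _ _ [z _ <-] [z' _ <-]; exists (a *: (z : hom X X) + z' : hom X X) => //.
  by rewrite !endoM compDl compZl.
have IS n m : I (n + m)%N `<=` I n.
  by move=> _ [z _ <-]; exists (g ^+ m * z) => //; rewrite mulrA -exprD addSn.
have JS n m : J (n + m)%N `<=` J n.
  by move=> _ [z _ <-]; exists (z * g ^+ m) => //; rewrite -mulrA -exprD addnS addnC.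
(* Minimizing the sum of both lengths gives one [N] at which both chains are stationary. *)
have [N Nmin] : exists N, forall n,
    (len (I N) + len (J N) <= len (I n) + len (J n))%N.
  pose P k := `[< exists N, k = len (I N) + len (J N) >]%N.
  have exP : exists k, P k.
    by exists (len (I 0%N) + len (J 0%N))%N; apply/asboolP; exists 0%N.
  case: (ex_minnP exP) => k /asboolP[N ->] Nmin; exists N => n.
  by apply: Nmin; apply/asboolP; exists n.
have IN : I (N + N.+1)%N = I N.
  apply: contrapT => /(ltlen _ _ (Isub _) (Isub _) (IS N N.+1)) ltI.
  have := Nmin (N + N.+1)%N; rewrite leqNgt; case/negP.
  by rewrite -addSn leq_add // lenS.
have JN : J (N + N.+1)%N = J N.
  apply: contrapT => /(ltlen _ _ (Jsub _) (Jsub _) (JS N N.+1)) ltJ.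
  have := Nmin (N + N.+1)%N; rewrite leqNgt; case/negP.
  by rewrite -addnS leq_add // lenS.
have [x _ xE] : I (N + N.+1)%N (g ^+ N.+1) by rewrite IN; exists 1; rewrite ?mulr1.
have [y _ yE] : J (N + N.+1)%N (g ^+ N.+1) by rewrite JN; exists 1; rewrite ?mul1r.
rewrite -addSn exprD in xE yE.
(* With [a = g ^+ N.+1]: [a = a * a * x = y * a * a], so [a * x] and [y * a] both equal
   [y * a * a * x]. *)
have xyE : g ^+ N.+1 * x = y * g ^+ N.+1.
  by rewrite -{1}yE -[in RHS]xE -!mulrA.
exists N, (g ^+ N.+1 * x), x, y; split=> //.
  by rewrite xyE -mulrA.
by rewrite mulrA.
Qed.

(** * Isomorphisms and endomorphisms of indecomposable objects *)

Lemma comp_mid (R : comPzRingType) (A : linCat R) (X Y Z V W : A)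
  (a : hom V W) (b : hom Z V) (c : hom Y Z) (d : hom X Y) :
  (a ∘ b) ∘ (c ∘ d) = a ∘ (b ∘ c) ∘ d.
Proof. by rewrite !compmA. Qed.

Lemma iso_id (R : comPzRingType) (A : addCat R) (X : A) : is_iso (idm X).
Proof. by exists (idm X); rewrite comp1m. Qed.

Lemma iso_comp (R : comPzRingType) (A : addCat R) (X Y Z : A) (g : hom Y Z)
  (f : hom X Y) : is_iso g -> is_iso f -> is_iso (g ∘ f).
Proof.
move=> [g' [g'g gg']] [f' [f'f ff']]; exists (f' ∘ g'); split.
  by rewrite -compmA (compmA g') g'g comp1m.
by rewrite -compmA (compmA f) ff' comp1m.
Qed.

Lemma iso_inv (R : comPzRingType) (A : addCat R) (X Y : A) (f : hom X Y) g g' :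
  g ∘ f = idm X -> f ∘ g' = idm Y -> is_iso f.
Proof.
move=> gf fg'; exists g; split=> //.
suff -> : g = g' by [].
by rewrite -[g]compm1 -fg' compmA gf comp1m.
Qed.

Lemma iso_two_sided (R : comPzRingType) (A : addCat R) (X Y : A) (f : hom X Y)
  (g g' : hom Y X) : is_iso (g ∘ f) -> is_iso (f ∘ g') -> is_iso f.
Proof.
move=> [u [ugf _]] [v [_ fg'v]]; apply: (@iso_inv _ _ _ _ f (u ∘ g) (g' ∘ v)).
  by rewrite -compmA.
by rewrite compmA.
Qed.

Lemma iso_zero (R : comPzRingType) (A : addCat R) (X Y : A) (f : hom X Y) :
  is_zero X -> is_zero Y -> is_iso f.
Proof.
by move=> X0 Y0; exists 0; rewrite comp0l comp0r; split; apply: esym.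
Qed.

Lemma nilpotent_iso (R : comPzRingType) (A : addCat R) (X : A) (g : endo X) N :
  g ^+ N = 0 -> is_iso (idm X - (g : hom X X)).
Proof.
move=> gN; pose S := \sum_(i < N) g ^+ i.
have gS : g * S = S * g.
  by apply: commr_sum => i _; apply: commrX.
have S1 : (1 - g) * S = 1.
  by rewrite -opprB mulNr -subrX1 gN sub0r opprK.
exists S; split; last exact: S1.
by rewrite -[RHS]S1; apply: etrans (mulrBr S 1 g) _; rewrite mulr1 -gS mulrBl mul1r.
Qed.

(** Locality of the endomorphism ring in the form given by Fitting's lemma; zero objects are
    included, since a cover may be zero. *)
Definition nil_or_iso (R : comPzRingType) (A : addCat R) (X : A) : Prop :=
  forall g : endo X, is_iso g \/ exists N, g ^+ N = 0.

(** The Fitting idempotent [e] of [g] and its complement split [X], so one summand vanishes: either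
    [e = 0] and a power of [g] is zero, or [e = 1] and [g] is invertible. *)
Lemma indecomposable_nil_or_iso (R : comPzRingType) (A : addCat R) (X : A) :
  idempotent_complete A -> finite_length (hom X X) -> indecomposable X ->
  nil_or_iso X.
Proof.
move=> icA flX [_ indX] g; have [N [e [x [y [eax eya ea ae]]]]] := fitting g flX.
have ee : e * e = e by rewrite {1}eya -mulrA ae -eya.
have [Y [r [s [sr rs]]]] := icA X e ee.
have ee' : (1 - e) * (1 - e) = 1 - e.
  by rewrite mulrBl mul1r mulrBr mulr1 ee subrr subr0.
have [Z [r' [s' [sr' rs']]]] := icA X (1 - e) ee'.
have rs'0 : r ∘ s' = 0.
  transitivity (r ∘ ((s ∘ r) ∘ (s' ∘ r')) ∘ s').
    by rewrite !compmA rs comp1m -(compmA (r ∘ s')) rs' compm1.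
  rewrite sr sr' -endoM mulrBr mulr1 ee subrr.
  by rewrite (_ : (0 : endo X) = (0 : hom X X)) // comp0r comp0l.
have r's0 : r' ∘ s = 0.
  transitivity (r' ∘ ((s' ∘ r') ∘ (s ∘ r)) ∘ s).
    by rewrite !compmA rs' comp1m -(compmA (r' ∘ s)) rs compm1.
  rewrite sr sr' -endoM mulrBl mul1r ee subrr.
  by rewrite (_ : (0 : endo X) = (0 : hom X X)) // comp0r comp0l.
have [Y0|Z0] : is_zero Y \/ is_zero Z.
  apply: indX; exists (in1 Y Z ∘ r + in2 Y Z ∘ r').
  exists (s ∘ pr1 Y Z + s' ∘ pr2 Y Z); split.
    rewrite compDl !compDr !comp_mid
       pr1_in1 pr2_in2 pr1_in2 pr2_in1 !compm1 !comp0r !comp0l addr0 add0r.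
    by rewrite sr sr' addrC subrK.
  rewrite compDl !compDr !comp_mid.
  by rewrite rs rs' rs'0 r's0 !compm1 !comp0r !comp0l addr0 add0r dsum_id.
- right; exists N.+1; rewrite -ea -sr (zero_dom s Y0).
  by rewrite endoM comp0l comp0l.
- left; have e1 : e = 1.
    by apply/esym/eqP; rewrite -subr_eq0 -sr' (zero_dom s' Z0) comp0l.
  rewrite e1 exprS in eax eya.
  apply: (@iso_inv _ _ _ _ g (y * g ^+ N) (g ^+ N * x)).
    by rewrite -[LHS]/(y * g ^+ N * g) -mulrA -exprSr exprS -eya.
  by rewrite -[LHS]/(g * (g ^+ N * x)) mulrA -eax.
Qed.

(** * Radical morphisms *)

(** Membership in the Jacobson radical of the category. *)
Definition radical (R : comPzRingType) (A : addCat R) (X Y : A) (f : hom X Y) :=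
  forall g : hom Y X, is_iso (idm X - g ∘ f).

(** If [u] inverts [1 - g f], then [1 + f u g] inverts [1 - f g]. *)
Lemma iso_1B_comp (R : comPzRingType) (A : addCat R) (X Y : A) (f : hom X Y)
  (g : hom Y X) : is_iso (idm X - g ∘ f) -> is_iso (idm Y - f ∘ g).
Proof.
move=> [u [ul ur]].
have gC : g ∘ (idm Y - f ∘ g) = (idm X - g ∘ f) ∘ g.
  by rewrite compDr compDl compNr compNl compm1 comp1m compmA.
have fC : (idm Y - f ∘ g) ∘ f = f ∘ (idm X - g ∘ f).
  by rewrite compDr compDl compNr compNl compm1 comp1m compmA.
exists (idm Y + f ∘ u ∘ g); split.
  by rewrite compDl comp1m -!compmA gC (compmA u) ul comp1m subrK.
by rewrite compDr compm1 !compmA fC -(compmA f) ur compm1 subrK.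
Qed.

Lemma radicalDr (R : comPzRingType) (A : addCat R) (X Y : A) (f f' : hom X Y) :
  radical f -> radical f' -> radical (f + f').
Proof.
move=> rf rf' g; have [u [u1 u2]] := rf g.
have := iso_comp (rf g) (rf' (u ∘ g)).
rewrite compDr compm1 compNr -!compmA (compmA _ u) u2 comp1m.
by rewrite compDr opprD addrA.
Qed.

Lemma radical0 (R : comPzRingType) (A : addCat R) (X Y : A) :
  radical (0 : hom X Y).
Proof. by move=> g; rewrite comp0r subr0; apply: iso_id. Qed.

Lemma radical_compl (R : comPzRingType) (A : addCat R) (X Y Z : A) (g : hom Y Z)
  (f : hom X Y) : radical f -> radical (g ∘ f).
Proof. by move=> rf h; rewrite compmA; apply: rf. Qed.

Lemma radical_compr (R : comPzRingType) (A : addCat R) (X Y Z : A) (g : hom Y Z)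
  (f : hom X Y) : radical g -> radical (g ∘ f).
Proof.
by move=> rg h; rewrite compmA; apply: iso_1B_comp; rewrite compmA; apply: rg.
Qed.

Lemma radical_sum (R : comPzRingType) (A : addCat R) (X Y : A) m
  (f : 'I_m -> hom X Y) :
  (forall i, radical (f i)) -> radical (\sum_(i < m) f i).
Proof.
move=> rf; apply: (big_ind (@radical R A X Y)) => //; first exact: radical0.
exact: radicalDr.
Qed.

(** If [g f] is nilpotent, a geometric series inverts [1 - g f]. If it is an isomorphism, [f] can be
    cancelled on the left, so nilpotence of [f] would make [X] zero and [f] an isomorphism after
    all. *)
Lemma radical_noniso (R : comPzRingType) (A : addCat R) (X : A) (f : endo X) :
  nil_or_iso X -> ~ is_iso f -> radical f.
Proof.
move=> lX nf g; have [[u [ugf _]]|[N gfN]] := lX (g ∘ f); last first.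
  exact: nilpotent_iso gfN.
case: nf; have [//|[N fN]] := lX f.
suff X0 : is_zero X by apply: iso_zero.
have vf : ((u : endo X) * (g : endo X)) * f = 1 by rewrite -mulrA.
elim: N fN => [//|N IH]; rewrite exprS => fN; apply: IH.
by rewrite -[LHS]mul1r -vf -mulrA fN mulr0.
Qed.

(** Radicality makes [1 - e] invertible for the Fitting idempotent [e = y * a], where [a] is a power
    of [f]; since [(1 - e) * a = 0], that power vanishes. *)
Lemma radical_nilpotent (R : comPzRingType) (A : addCat R) (X : A) (f : endo X) :
  finite_length (hom X X) -> radical f -> exists N, f ^+ N = 0.
Proof.
move=> flX rf; have [N [e [x [y [_ eya ea _]]]]] := fitting f flX.
have [u [u1 _]] := rf (y * f ^+ N).
have {}u1 : (u : endo X) * (1 - e) = 1 by rewrite eya exprSr mulrA; exact: u1.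
exists N.+1; rewrite -[LHS]mul1r -u1 -mulrA mulrBl mul1r ea subrr.
by rewrite mulr0.
Qed.

(** * Exactness properties of extriangles *)

(** Here and in the next three lemmas (ET3) or its dual compares the extriangle with a split one
    that has a zero end term. *)
Lemma extriangle_compr0 (R : comPzRingType) (A : extriCat R) (X Y Z : A)
  (d : EE Z X) (a : hom X Y) (b : hom Y Z) : realizes d a b -> b ∘ a = 0.
Proof.
move=> tri; have [|h [hE _]] := ET3 (f := idm X) (g := a ∘ pr1 X (zeroob A))
    (realizes_0 (zeroob A) X) tri.
  by rewrite -compmA pr1_in1.
rewrite -[a]compm1 -(pr1_in1 X (zeroob A)) !compmA -(compmA b) -hE.
by rewrite (zero_dom h (zeroobP A)) !comp0l.
Qed.

Lemma extriangle_pull0 (R : comPzRingType) (A : extriCat R) (X Y Z : A)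
  (d : EE Z X) (a : hom X Y) (b : hom Y Z) : realizes d a b -> pull b d = 0.
Proof.
move=> tri; have [|f [_ fE]] := ET3op (g := pr2 _ Y) (h := b)
    (realizes_0 Y (zeroob A)) tri.
  by [].
by rewrite -fE pushr0.
Qed.

Lemma extriangle_lift (R : comPzRingType) (A : extriCat R) (X Y Z W : A)
  (d : EE Z X) (a : hom X Y) (b : hom Y Z) (w : hom W Y) :
  realizes d a b -> b ∘ w = 0 -> exists w', w = a ∘ w'.
Proof.
move=> tri bw0.
have [|f [fE _]] := ET3op (g := w ∘ pr1 W (zeroob A)) (h := 0)
    (realizes_0 (zeroob A) W) tri.
  by rewrite comp0l compmA bw0 comp0l.
by exists f; rewrite -fE -compmA pr1_in1 compm1.
Qed.

Lemma extriangle_colift (R : comPzRingType) (A : extriCat R) (X Y Z W : A)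
  (d : EE Z X) (a : hom X Y) (b : hom Y Z) (w : hom Y W) :
  realizes d a b -> w ∘ a = 0 -> exists w', w = w' ∘ b.
Proof.
move=> tri wa0.
have [|h [hE _]] := ET3 (f := 0) (g := in2 (zeroob A) W ∘ w)
    tri (realizes_0 W (zeroob A)).
  by rewrite comp0r -compmA wa0 comp0r.
by exists h; rewrite hE compmA pr2_in2 comp1m.
Qed.

(** Realize [t] and apply the dual of (ET4): the extriangle over [pull a t] splits, and its
    retraction onto [W] pushes the extension [d3] to the required [u]. *)
Lemma extriangle_ext (R : comPzRingType) (A : extriCat R) (X Y Z W : A)
  (d : EE Z X) (a : hom X Y) (b : hom Y Z) (t : EE Y W) :
  realizes d a b -> pull a t = 0 -> exists u : EE Z W, t = pull b u.
Proof.
move=> tri at0; have [V [v [w vw]]] := realizes_ex t.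
have [E [h' [d3 [k [e [_ ke _ _ [_ bd3]]]]]]] := ET4op vw tri.
rewrite at0 in ke.
have [g [_ gk _]] := (realizes_class _ _ ke).1 (realizes_0 X W).
exists (push (pr1 W X ∘ g) d3).
by rewrite -push_pull bd3 -push_comp -compmA gk pr1_in1 push_id.
Qed.

Lemma extriangle_sq0 (R : comPzRingType) (A : extriCat R) (X Y Z : A)
  (d : EE Z X) (a : hom X Y) (b : hom Y Z) (g : endo Y) :
  realizes d a b -> (g : hom Y Y) ∘ a = 0 -> b ∘ (g : hom Y Y) = 0 -> g * g = 0.
Proof.
move=> tri ga bg; have [u gE] := extriangle_lift tri bg.
by rewrite endoM {2}gE compmA ga comp0l.
Qed.

(** * Endomorphisms of extriangles *)

Lemma ext_morphX (R : comPzRingType) (A : addCat R) (E : extFun A) (Z X : A)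
  (d : ext E Z X) (f : endo X) (h : endo Z) N :
  ext_morph d d f h -> ext_morph d d (f ^+ N) (h ^+ N).
Proof.
rewrite /ext_morph => fh; elim: N => [|N IH].
  by rewrite !expr0 push_id pull_id.
by rewrite !exprS !endoM push_comp IH push_pull fh pull_comp.
Qed.

Lemma intertwineX (R : comPzRingType) (A : linCat R) (X Y : A) (a : hom X Y)
  (f : endo X) (g : endo Y) N :
  (g : hom Y Y) ∘ a = a ∘ (f : hom X X) ->
  (g ^+ N : hom Y Y) ∘ a = a ∘ (f ^+ N : hom X X).
Proof.
move=> gf; elim: N => [|N IH]; first by rewrite !expr0 !endo1 comp1m compm1.
by rewrite !exprS !endoM -compmA IH !compmA gf.
Qed.

(** A high power of [g] kills [a] and is killed by [b], so its square is zero. *)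
Lemma extriangle_nilpotent (R : comPzRingType) (A : extriCat R) (X Y Z : A)
  (d : EE Z X) (a : hom X Y) (b : hom Y Z) (f : endo X) (g : endo Y) (h : endo Z)
  M N :
  realizes d a b -> (g : hom Y Y) ∘ a = a ∘ (f : hom X X) ->
  (h : hom Z Z) ∘ b = b ∘ (g : hom Y Y) -> f ^+ M = 0 -> h ^+ N = 0 ->
  exists K, g ^+ K = 0.
Proof.
move=> tri ga hb fM hN; exists ((M + N) + (M + N))%N; rewrite exprD.
apply: (extriangle_sq0 tri).
  by rewrite (intertwineX _ ga) exprD fM mul0r comp0r.
by rewrite -(intertwineX _ hb) exprD hN mulr0 comp0l.
Qed.

(** The inverses of [f] and [h] form a morphism of extensions, which lifts to some [g']. Both
    composites of [g] and [g'] agree with the identity along [a] and [b], so each differs from it by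
    an endomorphism of square zero. *)
Lemma extriangle_iso (R : comPzRingType) (A : extriCat R) (X Y Z : A)
  (d : EE Z X) (a : hom X Y) (b : hom Y Z) (f : endo X) (g : endo Y)
  (h : endo Z) :
  realizes d a b -> (g : hom Y Y) ∘ a = a ∘ (f : hom X X) ->
  (h : hom Z Z) ∘ b = b ∘ (g : hom Y Y) -> ext_morph d d f h ->
  is_iso f -> is_iso h -> is_iso g.
Proof.
move=> tri ga hb fh [f' [f'f ff']] [h' [h'h hh']].
have fh' : ext_morph d d f' h'.
  rewrite /ext_morph -[d in LHS]pull_id -hh' pull_comp -fh -push_pull.
  by rewrite -push_comp f'f push_id.
have [g' [ga' hb']] := realizes_morph tri tri fh'.
have sq0_iso (u : endo Y) :
    (u : hom Y Y) ∘ a = a -> b ∘ (u : hom Y Y) = b -> is_iso u.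
  move=> ua bu; rewrite -[u](subKr 1); apply: (@nilpotent_iso _ _ _ (1 - u) 2).
  rewrite expr2; apply: (extriangle_sq0 tri).
    by rewrite compDl compNl endo1 comp1m ua subrr.
  by rewrite compDr compNr endo1 compm1 bu subrr.
apply: (@iso_two_sided _ _ _ _ g g' g'); apply: sq0_iso.
- by rewrite -compmA ga compmA ga' -compmA f'f compm1.
- by rewrite compmA -hb' -compmA -hb compmA h'h comp1m.
- by rewrite -compmA ga' compmA ga -compmA ff' compm1.
- by rewrite compmA -hb -compmA -hb' compmA hh' comp1m.
Qed.

(** * Rigid extensions *)

(* What is needed of a minimal universal extension: [d] detects nilpotence and
   invertibility of the endomorphisms of its first end. *)
Record rigid_ext (R : comPzRingType) (A : extriCat R) (Z X : A)
    (d : EE Z X) : Prop :=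
  RigidExt {
    rigid_nil : forall f : endo X, push f d = 0 -> exists N, f ^+ N = 0;
    rigid_iso : forall (f : endo X) (h : endo Z),
      ext_morph d d f h -> is_iso h -> is_iso f
  }.

Lemma rigid_nilpotent (R : comPzRingType) (A : extriCat R) (X Y Z : A)
  (d : EE Z X) (a : hom X Y) (b : hom Y Z) (f : endo X) (g : endo Y)
  (h : endo Z) N :
  realizes d a b -> rigid_ext d -> (g : hom Y Y) ∘ a = a ∘ (f : hom X X) ->
  (h : hom Z Z) ∘ b = b ∘ (g : hom Y Y) -> ext_morph d d f h -> h ^+ N = 0 ->
  exists K, g ^+ K = 0.
Proof.
move=> tri [rn _] ga hb /(ext_morphX N) fhN hN.
rewrite /ext_morph hN pull0 in fhN.
have [M] := rn _ fhN; rewrite -exprM => fM.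
exact: (extriangle_nilpotent tri ga hb fM hN).
Qed.

(** As [b g a] vanishes, [g] induces [h] on [Z] and then [f] on [X]; rigidity transfers the
    alternative for [h] to [g]. *)
Lemma nil_or_iso_middle (R : comPzRingType) (A : extriCat R) (X Y Z : A)
  (d : EE Z X) (a : hom X Y) (b : hom Y Z) :
  realizes d a b -> rigid_ext d -> (forall w : hom X Z, w = 0) ->
  nil_or_iso Z -> nil_or_iso Y.
Proof.
move=> tri rd XZ0 lZ g.
have [h hb] := extriangle_colift tri (XZ0 (b ∘ g ∘ a)).
have [f [ga fh]] := ET3op tri tri (esym hb).
have [h_iso|[N hN]] := lZ h.
  left; apply: (extriangle_iso tri ga (esym hb) fh) => //.
  exact: rigid_iso fh h_iso.
right; exact: (rigid_nilpotent tri rd ga (esym hb) fh hN).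
Qed.

(* If [q b = 0] then [b = k c b] for some [c].  As [q k c = 0], [k c] is not
   an isomorphism, hence it is nilpotent, and so is the identity of [Y], which
   it accompanies in an endomorphism of the first extriangle. *)
Lemma composite_neq0 (R : comPzRingType) (A : extriCat R) (X Y Z K W : A)
  (d : EE Z X) (a : hom X Y) (b : hom Y Z)
  (eta : EE W K) (k : hom K Z) (q : hom Z W) :
  realizes d a b -> rigid_ext d -> realizes eta k q ->
  (forall w : hom X K, w = 0) -> nil_or_iso Z -> q <> 0 ->
  q ∘ b <> 0 \/ is_zero Y.
Proof.
move=> tri rd triq XK0 lZ qn0.
have [qb0|qbn0] := pselect (q ∘ b = 0); last by left.
right; have [c' bE] := extriangle_lift triq qb0.
have [c c'E] := extriangle_colift tri (XK0 (c' ∘ a)).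
have hb : (k ∘ c) ∘ b = b ∘ idm Y by rewrite compm1 -compmA -c'E -bE.
have [f [ga fh]] := ET3op tri tri hb.
have [[u [_ kcu]]|[N hN]] := lZ (k ∘ c).
  case: qn0; rewrite -[q]compm1 -kcu !compmA (extriangle_compr0 triq).
  by rewrite !comp0l.
have [M] := rigid_nilpotent (g := 1) tri rd ga hb fh hN.
by rewrite expr1n.
Qed.

(** * Minimal universal extensions *)

(** Otherwise adjoining elements outside the span, again and again, would give submodules of
    unbounded length. *)
Lemma finitely_generated (R : comPzRingType) (A : extriCat R) (Z X : A) :
  finite_length (EE Z X) -> exists m (eps : nat -> EE Z X),
    forall t, exists c : nat -> hom X X, t = \sum_(i < m) push (c i) (eps i).
Proof.
move=> /finite_length_measure[len [lenS ltlen]].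
pose span m (eps : nat -> EE Z X) : set (EE Z X) :=
  [set t | exists c : nat -> hom X X, t = \sum_(i < m) push (c i) (eps i)].
have span_sub m eps : submodule (span m eps).
  apply/submoduleP; split.
    by exists (fun=> 0); rewrite big1 // => i _; rewrite push0.
  move=> a _ _ [c ->] [c' ->]; exists (fun i => a *: c i + c' i).
  rewrite scaler_sumr -big_split; apply: eq_bigr => i _ /=.
  by rewrite pushDh pushZh.
apply: contrapT => nfg.
suff /(_ (len setT).+1)[eps] : forall m, exists eps, (m <= len (span m eps))%N.
  by rewrite ltnNge lenS.
elim=> [|m [eps leps]]; first by exists (fun=> 0).
have [t nt] : exists t, ~ span m eps t.
  apply: contrapT => nt; apply: nfg; exists m, eps => t.
  by apply: contrapT => nst; apply: nt; exists t.
exists (fun i => if (i < m)%N then eps i else t).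
apply: (leq_ltn_trans leps); apply: ltlen => //.
  move=> _ [c ->]; exists (fun i => if (i < m)%N then c i else 0).
  rewrite big_ord_recr /= ltnn push0 addr0; apply: eq_bigr => i _.
  by rewrite ltn_ord.
move=> spanE; apply: nt; rewrite spanE.
exists (fun i => if (i < m)%N then 0 else idm X).
rewrite big_ord_recr /= ltnn push_id big1 ?add0r// => i _.
by rewrite ltn_ord push0.
Qed.

(** A generating family of least size works: a relation with an invertible coefficient would express
    one generator through the others. *)
Lemma minimal_generators (R : comPzRingType) (A : extriCat R) (Z X : A) :
  finite_length (EE Z X) -> exists m (eps : nat -> EE Z X),
    (forall t, exists c : nat -> hom X X, t = \sum_(i < m) push (c i) (eps i)) /\
    (forall c : nat -> hom X X, \sum_(i < m) push (c i) (eps i) = 0 ->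
       forall i, (i < m)%N -> ~ is_iso (c i)).
Proof.
move=> /finitely_generated fg.
pose gen m (eps : nat -> EE Z X) :=
  forall t, exists c : nat -> hom X X, t = \sum_(i < m) push (c i) (eps i).
have exm : exists m, `[< exists eps, gen m eps >].
  by have [m [eps g]] := fg; exists m; apply/asboolP; exists eps.
case: (ex_minnP exm) => m /asboolP[eps epsG] mmin.
exists m, eps; split=> // c c0 k ltkm [u [uck _]].
case: m => [//|m] in epsG mmin c0 ltkm *.
suff /asboolP/mmin : exists eps', gen m eps' by rewrite ltnn.
exists (eps \o bump k) => t; have [c' ->] := epsG t.
pose j := Ordinal ltkm.
have epsk : eps k = \sum_(i < m) push (- (u ∘ c (bump k i))) (eps (bump k i)).
  have /(congr1 (push u)) := c0.
  rewrite pushr0 push_sum (bigD1_ord j)//= -push_comp uck push_id.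
  move=> /eqP; rewrite addr_eq0 => /eqP ->; rewrite -sumrN.
  by apply: eq_bigr => i _; rewrite pushNh push_comp.
exists (fun i => c' (bump k i) - c' k ∘ u ∘ c (bump k i)).
rewrite (bigD1_ord j)//= {1}epsk push_sum -big_split; apply: eq_bigr => i _ /=.
by rewrite pushDh addrC -push_comp compNr compmA.
Qed.

(** Filtrations without stages or indices, for proofs by induction; [filtP] recovers the indexed
    form. *)
Inductive filt (R : comPzRingType) (A : extriCat R) (P : A -> Prop) : A -> Prop :=
| filt_zero M : is_zero M -> filt P M
| filt_step M M' X (d : EE X M) (a : hom M M') (b : hom M' X) :
    filt P M -> P X -> realizes d a b -> filt P M'.

(** The [m]-fold direct sum of [X], with structure maps indexed by [nat] to avoid casts between
    ordinals; a split extriangle adds each summand. *)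
Lemma powers (R : comPzRingType) (A : extriCat R) (P : A -> Prop) (X : A) m :
  P X -> exists (Y : A) (inj : nat -> hom X Y) (prj : nat -> hom Y X),
    [/\ filt P Y,
        forall k l, (k < m)%N -> (l < m)%N ->
          prj k ∘ inj l = if k == l then idm X else 0 &
        \sum_(k < m) inj k ∘ prj k = idm Y].
Proof.
move=> PX; elim: m => [|m [Y [inj [prj [fY orth sum1]]]]].
  exists (zeroob A), (fun=> 0), (fun=> 0); split=> //.
    by apply: filt_zero; apply: zeroobP.
  by rewrite big_ord0 zeroobP.
exists (dsum Y X), (fun k => if (k < m)%N then in1 Y X ∘ inj k else in2 Y X).
exists (fun k => if (k < m)%N then prj k ∘ pr1 Y X else pr2 Y X); split.
- exact: filt_step fY PX (realizes_0 X Y).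
- move=> k l; rewrite !ltnS leq_eqVlt => /predU1P[->|ltkm];
    rewrite leq_eqVlt => /predU1P[->|ltlm].
  + by rewrite ltnn eqxx pr2_in2.
  + by rewrite ltnn ltlm gtn_eqF// compmA pr2_in1 comp0l.
  + by rewrite ltnn ltkm ltn_eqF// -compmA pr1_in2 comp0r.
  + by rewrite ltkm ltlm comp_mid pr1_in1 compm1 orth.
rewrite big_ord_recr /= ltnn -[RHS]dsum_id; congr (_ + _).
rewrite -[in1 Y X in RHS]compm1 -sum1 comp_sumr comp_suml.
by apply: eq_bigr => i _; rewrite ltn_ord comp_mid.
Qed.

(** The components of [d] are the minimal generators [eps]. Generation makes every extension of [Z]
    by [X] or [Y] a pushout of [d]; minimality puts the endomorphisms that annihilate [d] into the
    radical. *)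
Lemma minimal_universal_ext (R : comPzRingType) (A : extriCat R) (P : A -> Prop)
  (Z X : A) :
  artin A -> nil_or_iso X -> P X -> exists (Y : A) (d : EE Z Y),
    [/\ filt P Y, rigid_ext d & forall t : EE Z X, exists x, t = push x d].
Proof.
move=> [_ flhom flE] lX PX.
have [m [eps [epsG epsM]]] := minimal_generators (flE Z X).
have [Y [inj [prj [fY orth sum1]]]] := powers m PX.
pose d : EE Z Y := \sum_(i < m) push (inj i) (eps i).
have pushd W (u : hom Y W) : push u d = \sum_(i < m) push (u ∘ inj i) (eps i).
  by rewrite push_sum; apply: eq_bigr => i _; rewrite push_comp.
have univX (t : EE Z X) : exists x, t = push x d.
  have [c ->] := epsG t; exists (\sum_(k < m) c k ∘ prj k).
  rewrite pushd; apply: eq_bigr => i _; rewrite comp_suml.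
  rewrite (bigD1 i)//= -compmA orth ?eqxx// compm1 big1 ?addr0// => k ki.
  by rewrite -compmA orth // ifN ?comp0r.
have univ (t : EE Z Y) : exists f : hom Y Y, t = push f d.
  have [x xE] := choice (fun k => univX (push (prj k) t)).
  exists (\sum_(k < m) inj k ∘ x k).
  rewrite push_sumh -[LHS]push_id -sum1 push_sumh; apply: eq_bigr => k _.
  by rewrite push_comp xE push_comp.
(* Here [push u d = 0] is a relation between the generators with coefficients [u ∘ inj i], none of
   them invertible by minimality. *)
have radX (u : hom Y X) : push u d = 0 -> radical u.
  rewrite pushd => u0; rewrite -[u]compm1 -sum1 comp_sumr.
  apply: radical_sum => i; rewrite compmA; apply: radical_compr.
  apply: radical_noniso => //.
  exact: (epsM (fun k => u ∘ inj k) u0).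
have rad (f : hom Y Y) : push f d = 0 -> radical f.
  move=> f0; rewrite -[f]comp1m -sum1 comp_suml.
  apply: radical_sum => i; rewrite -compmA; apply: radical_compl; apply: radX.
  by rewrite push_comp f0 pushr0.
exists Y, d; split=> //; split=> [f /rad|f h fh [h' [h'h hh']]].
  exact: radical_nilpotent.
(* Both composites of [f] and [f'] will fix [d], so they are the identity minus a radical
   endomorphism. *)
have [f' f'E] := univ (pull h' d).
have iso_fix (g : hom Y Y) : push g d = d -> is_iso g.
  move=> gd; have /rad/(_ (idm Y)) : push (idm Y - g) d = 0.
    by rewrite pushDh pushNh push_id gd subrr.
  by rewrite comp1m subKr.
apply: (@iso_two_sided _ _ _ _ f f' f'); apply: iso_fix.
  by rewrite push_comp fh push_pull -f'E -pull_comp h'h pull_id.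
by rewrite push_comp -f'E push_pull fh -pull_comp hh' pull_id.
Qed.

(** * Closure and vanishing properties of filtered objects *)

Lemma filt_sub (R : comPzRingType) (A : extriCat R) (P P' : A -> Prop) (M : A) :
  (forall X, P X -> P' X) -> filt P M -> filt P' M.
Proof.
move=> PP'; elim=> [M0 M00|M0 M' X d a b _ fM0 PX tri]; first exact: filt_zero.
exact: filt_step fM0 (PP' X PX) tri.
Qed.

Lemma filt_iso (R : comPzRingType) (A : extriCat R) (P : A -> Prop) (M M' : A)
  (f : hom M M') : filt P M -> is_iso f -> filt P M'.
Proof.
move=> fM; case: M / fM f => [M M0 f [f' [_ ff']]|M0 M X d a b fM0 PX tri f fiso].
  by apply: filt_zero; rewrite /is_zero -ff' (zero_dom f M0) comp0l.
have [f' [f'f _]] := fiso.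
apply: (filt_step (a := f ∘ a) (b := b ∘ f') (d := d) fM0 PX).
apply: (realizes_class _ _ tri).2; exists f; split=> //.
by rewrite -compmA f'f compm1.
Qed.

(** By induction on the filtration of [Z]: the dual of (ET4) turns its last step [M -> Z -> W] into
    [E -> Y -> W], with [E] an extension of [M] by [X]. *)
Lemma filt_extension (R : comPzRingType) (A : extriCat R) (P : A -> Prop)
  (X Y Z : A) (d : EE Z X) (a : hom X Y) (b : hom Y Z) :
  filt P X -> filt P Z -> realizes d a b -> filt P Y.
Proof.
move=> fX fZ; elim: fZ Y d a b => [{}Z Z0|M {}Z W d0 a0 b0 _ IH PW tri0] Y d a b tri.
  rewrite [d]ext_zero_dom// in tri.
  have [g [giso _ _]] := (realizes_class _ _ (realizes_0 Z X)).1 tri.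
  apply: (filt_iso (f := g ∘ in1 X Z) fX); apply: iso_comp giso _.
  exists (pr1 X Z); split; first exact: pr1_in1.
  by rewrite -dsum_id (zero_dom (in2 X Z) Z0) comp0l addr0.
have [E [h' [d3 [k [e [tri3 trie _ _ _]]]]]] := ET4op tri tri0.
exact: filt_step (IH _ _ _ _ trie) PW tri3.
Qed.

(** Here and in the next two lemmas the vanishing passes through each step of the filtration by
    exactness in the middle. *)
Lemma filt_ext0 (R : comPzRingType) (A : extriCat R) (P : A -> Prop) (M Y : A) :
  filt P M -> (forall X, P X -> forall d : EE X Y, d = 0) ->
  forall d : EE M Y, d = 0.
Proof.
move=> fM PY; elim: fM => [M0 M00 d|M0 M' X d a b _ IH PX tri t].
  exact: ext_zero_dom.
by have [u ->] := extriangle_ext tri (IH (pull a t)); rewrite (PY X PX u) pullr0.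
Qed.

Lemma filt_hom0l (R : comPzRingType) (A : extriCat R) (P : A -> Prop) (M Y : A) :
  filt P M -> (forall X, P X -> forall w : hom X Y, w = 0) ->
  forall w : hom M Y, w = 0.
Proof.
move=> fM PY; elim: fM => [M0 M00 w|M0 M' X d a b _ IH PX tri w].
  exact: zero_dom.
by have [u ->] := extriangle_colift tri (IH (w ∘ a)); rewrite (PY X PX u) comp0l.
Qed.

Lemma filt_hom0r (R : comPzRingType) (A : extriCat R) (P : A -> Prop) (M Y : A) :
  filt P M -> (forall X, P X -> forall w : hom Y X, w = 0) ->
  forall w : hom Y M, w = 0.
Proof.
move=> fM PY; elim: fM => [M0 M00 w|M0 M' X d a b _ IH PX tri w].
  exact: zero_cod.
by have [u ->] := extriangle_lift tri (PY X PX (b ∘ w)); rewrite (IH u) comp0r.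
Qed.

(** * From the inductive predicate to indexed filtrations *)

Definition in_extriangle (R : comPzRingType) (A : extriCat R) (X Y Z : A) : Prop :=
  exists (d : EE Z X) (a : hom X Y) (b : hom Y Z), realizes d a b.

Lemma filtered_build (R : comPzRingType) (A : extriCat R) (P : A -> Prop)
  (stage factor : nat -> A) (t : nat) :
  (forall i, (i <= t)%N -> in_extriangle (stage i) (stage i.+1) (factor i)) ->
  is_zero (stage 0%N) -> is_zero (stage 1%N) -> is_zero (factor 0%N) ->
  (forall i, (1 <= i <= t)%N -> P (factor i)) -> filtered P (stage t.+1).
Proof.
move=> tri s0 s1 f0 fP.
have ex i : exists x : hom (stage i) (stage i.+1) * hom (stage i.+1) (factor i) *
    EE (factor i) (stage i), (i <= t)%N -> realizes x.2 x.1.1 x.1.2.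
  have [le_it|_] := boolP (i <= t)%N; last by exists 0.
  by have [d [a [b dab]]] := tri i le_it; exists (a, b, d).
pose x i := projT1 (cid (ex i)).
exists t; constructor; apply: (@Filtration _ _ _ _ _ stage factor
  (fun i => (x i).1.1) (fun i => (x i).1.2) (fun i => (x i).2)) => // i le_it.
exact: projT2 (cid (ex i)) le_it.
Qed.

Lemma filtP (R : comPzRingType) (A : extriCat R) (P : A -> Prop) (M : A) :
  filt P M -> filtered P M.
Proof.
elim=> [M0 M00|M0 M' X d a b _ [t [F]] PX tri].
  (* All stages are [M0] itself, because the top stage must equal [M0] and not just be isomorphic to
     it. *)
  apply: (@filtered_build _ _ _ (fun=> M0) (fun=> M0) 0%N) => // [_ _|[]//].
  exists 0, 0, 0; apply: (realizes_class _ _ (realizes_0 M0 M0)).2.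
  exists 0; split=> [||]; [|by rewrite comp0l|by rewrite comp0l [RHS]zero_cod].
  apply: iso_zero => //; rewrite /is_zero -dsum_id.
  by rewrite (zero_dom (in1 M0 M0) M00) (zero_dom (in2 M0 M0) M00) !comp0l addr0.
(* The old top is stage [t.+1], so [M'] becomes stage [t.+2] and [X] the factor of index [t.+1]. *)
pose s i := if (i <= t.+1)%N then stage F i else M'.
pose f i := if (i <= t)%N then factor F i else X.
have -> : M' = s t.+2 by rewrite /s ltnn.
apply: (@filtered_build _ _ P s f t.+1).
- move=> i; rewrite leq_eqVlt /s /f => /predU1P[->|]; last first.
    rewrite ltnS => le_it; rewrite le_it (leq_trans le_it (leqnSn t)).
    by exists (stage_ext F i), (stage_inf F i), (stage_def F i); apply: (stage_tri F).
  by rewrite leqnn !ltnn (stage_top F); exists d, a, b.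
- exact: (stage0 F).
- exact: (stage1 F).
- exact: (factor0 F).
- move=> i /andP[i0 _]; rewrite /f; case: leqP => [le_it|//].
  by apply: (factorP F); rewrite i0.
Qed.

(** * Construction of the covers *)

(* The cover of [Phi i] obtained after killing the extensions of the objects
   [Phi l] with [l < j]. *)
Record partial_cover (R : comPzRingType) (A : extriCat R) (n : nat)
    (Phi : 'I_n -> A) (i : 'I_n) (j : nat) (K Q : A) (k : hom K Q)
    (q : hom Q (Phi i)) (eta : EE (Phi i) K) : Prop := PartialCover {
  cover_tri : realizes eta k q;
  cover_filt : filt (fun X => exists l : 'I_n, (i < l < j)%N /\ X = Phi l) K;
  cover_nil_or_iso : nil_or_iso Q;
  cover_neq0 : q <> 0 \/ is_zero Q;
  cover_proj : forall (l : 'I_n) (d : EE Q (Phi l)), (l < j)%N -> d = 0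
}.
Arguments partial_cover {R A n} Phi i j {K Q} k q eta.

Lemma partial_cover_ex (R : comPzRingType) (A : extriCat R) (n : nat)
  (Phi : 'I_n -> A) (i : 'I_n) (j : nat) :
  artin A -> stratifying_system Phi -> (i < j <= n)%N ->
  exists (K Q : A) (k : hom K Q) (q : hom Q (Phi i)) (eta : EE (Phi i) K),
    partial_cover Phi i j k q eta.
Proof.
move=> artA [indPhi hom0 ext0]; have [icA flhom flE] := artA.
have lPhi l : nil_or_iso (Phi l) by apply: indecomposable_nil_or_iso.
elim: j => [|j IH]; first by rewrite ltn0.
rewrite ltnS leq_eqVlt => /andP[/predU1P[<- _|lt_ij lt_jn]].
  (* The start has zero kernel: (S2) already gives [E(Phi i, Phi l) = 0] for [l <= i]. *)
  exists (zeroob A), (Phi i), 0, (idm (Phi i)), 0; split => //.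
  - apply: (realizes_class _ _ (realizes_0 _ _)).2.
    exists (pr2 (zeroob A) (Phi i)); split.
    + exists (in2 (zeroob A) (Phi i)); split; last exact: pr2_in2.
      by rewrite -dsum_id [pr1 _ _](zero_cod _ (zeroobP A)) comp0r add0r.
    + exact: pr2_in1.
    + exact: comp1m.
  - by apply: filt_zero; apply: zeroobP.
  - by left; have [] := indPhi i.
  - by move=> l d; rewrite ltnS => /ext0.
have [|K [Q [k [q [eta [tri fK lQ qn0 proj]]]]]] := IH.
  by rewrite lt_ij ltnW.
have sub l : (i < l < j)%N -> (i < l < j.+1)%N.
  by move=> /andP[-> lt_lj]; rewrite ltnS ltnW.
have fK' : filt (fun X => exists l : 'I_n, (i < l < j.+1)%N /\ X = Phi l) K.
  by apply: filt_sub fK => X [l [/sub lj ->]]; exists l.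
case: qn0 => [qn0|Q0]; last first.
  exists K, Q, k, q, eta; split=> //; first by right.
  by move=> l d _; apply: ext_zero_dom.
pose J := Ordinal lt_jn.
have [P [d [fP rd univ]]] :=
  minimal_universal_ext (P := fun X => X = Phi J) Q artA (lPhi J) erefl.
have [Q' [a [b trib]]] := realizes_ex d.
(* By (S1) [P], being filtered by [Phi J], has only zero maps to the earlier objects, hence also to
   [K] and [Q]. *)
have hom0P (l : 'I_n) : (l < j)%N -> forall w : hom P (Phi l), w = 0.
  by move=> lt_lj; apply: (filt_hom0l fP) => X -> w; apply: hom0.
have hom0K (w : hom P K) : w = 0.
  apply: (filt_hom0r fK) => X [l [/andP[_ lt_lj] ->]]; exact: hom0P.
have hom0Q (w : hom P Q) : w = 0.
  have [u ->] := extriangle_lift tri (hom0P i lt_ij (q ∘ w)).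
  by rewrite (hom0K u) comp0r.
(* Composing the deflations [b] and [q] makes the new kernel [K'] an extension of [K] by [P]. *)
have [K' [k' [eta' [c [e [tri' trie _ _ _]]]]]] := ET4op trib tri.
exists K', Q', k', (q ∘ b), eta'; split=> //.
- apply: filt_extension _ fK' trie.
  by apply: filt_sub fP => X ->; exists J; rewrite lt_ij /= ltnSn.
- exact: nil_or_iso_middle trib rd hom0Q lQ.
- exact: composite_neq0 trib rd tri hom0K lQ qn0.
(* By (S2) [t] vanishes on [P], so it comes from some [u] over [Q]: zero by induction if [l < j],
   and a pushout of [d], which [b] pulls back to zero, if [l = j]. *)
- move=> l t; rewrite ltnS leq_eqVlt => lj.
  have Pl : pull a t = 0.
    apply: (filt_ext0 fP) => X -> u; apply: ext0.
    by rewrite leq_eqVlt.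
  have [u ->] := extriangle_ext trib Pl.
  case/predU1P: lj => [lj|lj]; last by rewrite (proj l u lj) pullr0.
  have lJ : l = J by apply: val_inj.
  rewrite lJ in u *; have [x ->] := univ u.
  by rewrite -push_pull (extriangle_pull0 trib) pushr0.
Qed.

(** If [q g = q] with [g] nilpotent, then [q = q g^N = 0]. *)
Lemma nil_or_iso_minimal (R : comPzRingType) (A : extriCat R) (X Y : A)
  (q : hom X Y) : nil_or_iso X -> q <> 0 \/ is_zero X -> right_minimal q.
Proof.
move=> lX qn0 g qg; case: qn0 => [qn0|X0]; last exact: iso_zero.
have [//|[N gN]] := lX g; case: qn0.
suff <- : q ∘ ((g : endo X) ^+ N) = q by rewrite gN comp0r.
by elim: N {gN} => [|N IH]; rewrite ?compm1// exprS endoM compmA qg.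
Qed.

Theorem theorem1 (R : comPzRingType) (R_artinian : artinian R)
    (A : extriCat R) (A_artin : artin A)
    (n : nat) (Phi : 'I_n -> A) (Phi_strat : stratifying_system Phi) :
  exists Q : 'I_n -> A,
    (forall i, filtered (fun X => exists j, X = Phi j) (Q i)) /\
    exists S : proj_stratifying_system Phi Q, minimal S.
Proof.
have ex i :
    exists x : {K : A & {Q : A & hom K Q * hom Q (Phi i) * EE (Phi i) K}}%type,
    let y := projT2 (projT2 x) in partial_cover Phi i n y.1.1 y.1.2 y.2.
  have [|K [Q [k [q [eta cov]]]]] :=
      partial_cover_ex (i := i) (j := n) A_artin Phi_strat.
    by rewrite ltn_ord leqnn.
  by exists (existT _ K (existT _ Q (k, q, eta))).
pose x i := projT1 (cid (ex i)).
have cov i : partial_cover Phi i n _ _ _ := projT2 (cid (ex i)).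
exists (fun i => projT1 (projT2 (x i))); split.
  (* The cover adds to its kernel one filtration step, with factor [Phi i]. *)
  move=> i; apply: filtP; apply: (filt_step _ _ (cover_tri (cov i))); last by exists i.
  by apply: filt_sub (cover_filt (cov i)) => X [l [_ ->]]; exists l.
unshelve eexists.
  apply: (@ProjStratifyingSystem _ _ _ _ _ Phi_strat _ (fun i => projT1 (x i))
    (fun i => (projT2 (projT2 (x i))).1.1) (fun i => (projT2 (projT2 (x i))).1.2)
    (fun i => (projT2 (projT2 (x i))).2)) => [i j d|i|i].
  - exact: cover_proj (cov i) _ d (ltn_ord j).
  - exact: cover_tri (cov i).
  - apply: filtP; apply: filt_sub (cover_filt (cov i)) => X [l [/andP[il _] ->]].
    by exists l.
move=> i /=; apply: nil_or_iso_minimal; first exact: cover_nil_or_iso (cov i).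
exact: cover_neq0 (cov i).
Qed.
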